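(* Consider a smooth deterministic function-constrained variational inequality and run the Adaptive Operator Extrapolation method (both described in the context) with $c_1=c_2=6$, i.e. with $$\beta=\frac{12M_g^2}{c_1^2L^2}=\frac{M_g^2}{3L^2},\quad \eta_t=6L+6L_g\max_{1\le i\le t}\|\lambda^i\|,\quad \gamma_t=\frac{\eta_0}{\eta_t},\quad \theta_t=\frac{\gamma_{t-1}}{\gamma_t},\quad \tau_t=\beta\eta_t .$$ Then the method has an $O(1/T)$ convergence rate: there is a constant $C$, independent of $T$, such that for every $T\ge1$ $$\max_{x\in\widetilde X}\langle F(x),\bar x^T-x\rangle\le\frac CT,\qquad \|[g(\bar x^T)]_+\|\le\frac CT .$$
   Context: Setting (smooth deterministic FCVI). $\|\cdot\|$ is the Euclidean norm. $X\subset\mathbb R^n$ is a convex compact set, $F:X\to\mathbb R^n$ is monotone, i.e. $\langle F(x_1)-F(x_2),x_1-x_2\rangle\ge0$ on $X$, and $L$-Lipschitz: $\|F(x_1)-F(x_2)\|\le L\|x_1-x_2\|$. The functions $g_j:X\to\mathbb R$, $j=1,\dots,m$, are convex and differentiable; $g_j$ is $M_{g_j}$-Lipschitz with $\|\nabla g_j(x)\|\le M_{g_j}$, and $\nabla g_j$ is $L_{g_j}$-Lipschitz. Put $g=(g_1,\dots,g_m)^T$, $\nabla g(x)=[\nabla g_1(x),\dots,\nabla g_m(x)]\in\mathbb R^{n\times m}$, $M_g=(\sum_jM_{g_j}^2)^{1/2}$, $L_g=(\sum_jL_{g_j}^2)^{1/2}$, $\widetilde X=X\cap\{x:g(x)\le\mathbf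 0\}$; $[\cdot]_+$ is the componentwise positive part. The constants $L, M_g$ are positive. The FCVI asks for $x^*\in\widetilde X$ with $\langle F(x^* ),x-x^*\rangle\ge0$ for all $x\in\widetilde X$. Standing assumption: there exist a solution $x^*$ and $\lambda^*\in\mathbb R^m_+$ with $\mathbf 0\in F(x^* )+\sum_j\lambda_j^*\nabla g_j(x^* )+N_X(x^* )$ and $\lambda^*_jg_j(x^* )=0$ for all $j$, where $N_X(x^* )=\{v:\langle v,\tilde x-x^*\rangle\le0\ \forall\tilde x\in X\}$. Adaptive Operator Extrapolation method. Input $x^0\in X$, $\lambda^0=\mathbf 0$; set $x^{-1}=x^0$, $\lambda^{-1}=\lambda^0$. For $t=0,1,2,\dots$: $s^t=(1+\theta_t)g(x^t)-\theta_tg(x^{t-1})$; $\lambda^{t+1}=\arg\min_{\lambda\ge\mathbf 0}\langle -s^t,\lambda\rangle+\frac{\tau_t}{2}\|\lambda-\lambda^t\|^2$; $u^t=(1+\theta_t)[F(x^t)+\nabla g(x^t)\lambda^t]-\theta_t[F(x^{t-1})+\nabla g(x^{t-1})\lambda^{t-1}]$; $x^{t+1}=\arg\min_{x\in X}\langle u^t,x\rangle+\frac{\eta_t}{2}\|x-x^t\|^2$. The maximum over the empty set (at $t=0$) is $0$; $\theta_0$ has no effect, so $\gamma_{-1}$ may be chosen arbitrarily. The output after $T$ iterations is $\bar x^T=\big(\sum_{t=0}^{T-1}\gamma_tx^{t+1}\big)/\big(\sum_{t=0}^{T-1}\gamma_t\big)$. *)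

(* Defs.v *)
(* MathComp-Analysis, over an arbitrary R : realType. *)
From HB Require Import structures.
From mathcomp Require Import all_boot all_order all_algebra.
From mathcomp Require Import all_classical all_reals all_analysis.

Set Implicit Arguments.
Unset Strict Implicit.
Unset Printing Implicit Defensive.

Import Order.TTheory GRing.Theory Num.Theory.
Import numFieldNormedType.Exports.

Local Open Scope classical_set_scope.
Local Open Scope ring_scope.

Section Euclidean.
Context {R : realType}.
Implicit Types n p : nat.

Definition dotv n (u v : 'cV[R]_n) : R := \sum_i u i 0 * v i 0.

(* The library norm `|u| on matrices is the sup norm, hence this one. *)
Definition enorm n (u : 'cV[R]_n) : R := Num.sqrt (dotv u u).

Definition elipschitz_on n p (X : set 'cV[R]_n) (k : R)
    (f : 'cV[R]_n -> 'cV[R]_p) : Prop :=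
  forall x y, X x -> X y -> enorm (f x - f y) <= k * enorm (x - y).

Definition monotone_on n (X : set 'cV[R]_n) (F : 'cV[R]_n -> 'cV[R]_n) : Prop :=
  forall x y, X x -> X y -> 0 <= dotv (F x - F y) (x - y).

(* v is a gradient at x of f seen as a function on X only: the expansion is
   required along points of X, so f need not be differentiable, or even
   meaningful, outside X. *)
Definition gradient_on n (X : set 'cV[R]_n) (f : 'cV[R]_n -> R)
    (x v : 'cV[R]_n) : Prop :=
  (fun y => f y - f x - dotv v (y - x) : R^o)
    =o_ (within X (nbhs x)) (fun y => enorm (y - x) : R^o).

Definition nonnegv n (u : 'cV[R]_n) : Prop := forall i, 0 <= u i 0.

Definition pospart n (u : 'cV[R]_n) : 'cV[R]_n := \col_i Num.max (u i 0) 0.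

Definition normal_cone n (X : set 'cV[R]_n) (x : 'cV[R]_n) : set 'cV[R]_n :=
  [set v | forall y, X y -> dotv v (y - x) <= 0].

Definition is_argmin T (D : set T) (f : T -> R) (x : T) : Prop :=
  D x /\ forall y, D y -> f x <= f y.

Definition is_max (A : set R) (M : R) : Prop := A M /\ ubound A M.

Definition l2agg p (c : 'I_p -> R) : R := Num.sqrt (\sum_j c j ^+ 2).

End Euclidean.

Section FCVI.
Context {R : realType} {n m : nat}.

Definition feasible (X : set 'cV[R]_n) (g : 'cV[R]_n -> 'cV[R]_m) :
    set 'cV[R]_n :=
  [set x | X x /\ forall j, g x j 0 <= 0].

(* F, g and dg are total functions of which only the values on X matter;
   column j of dg x is the gradient at x of the j-th component of g. *)
Record smooth_FCVI (X : set 'cV[R]_n) (F : 'cV[R]_n -> 'cV[R]_n)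
    (g : 'cV[R]_n -> 'cV[R]_m) (dg : 'cV[R]_n -> 'M[R]_(n, m))
    (L : R) (Mg Lg : 'I_m -> R) : Prop := {
  FCVI_convex_set : convex_set X ;
  FCVI_compact : compact X ;
  FCVI_monotone : monotone_on X F ;
  FCVI_lipschitz : elipschitz_on X L F ;
  FCVI_convex_fun : forall j, convex_function X (fun x => g x j 0) ;
  FCVI_gradient : forall j x, X x ->
    gradient_on X (fun y => g y j 0) x (col j (dg x)) ;
  FCVI_g_lipschitz : forall j x y, X x -> X y ->
    `|g x j 0 - g y j 0| <= Mg j * enorm (x - y) ;
  FCVI_gradient_bound : forall j x, X x -> enorm (col j (dg x)) <= Mg j ;
  FCVI_gradient_lipschitz : forall j,
    elipschitz_on X (Lg j) (fun x => col j (dg x)) ;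
  FCVI_L_gt0 : 0 < L ;
  FCVI_Mg_gt0 : 0 < l2agg Mg
}.

Definition FCVI_solution (X : set 'cV[R]_n) (F : 'cV[R]_n -> 'cV[R]_n)
    (g : 'cV[R]_n -> 'cV[R]_m) (xs : 'cV[R]_n) : Prop :=
  feasible X g xs /\ forall x, feasible X g x -> 0 <= dotv (F xs) (x - xs).

Definition KKT (X : set 'cV[R]_n) (F : 'cV[R]_n -> 'cV[R]_n)
    (g : 'cV[R]_n -> 'cV[R]_m) (dg : 'cV[R]_n -> 'M[R]_(n, m))
    (xs : 'cV[R]_n) (ls : 'cV[R]_m) : Prop :=
  [/\ nonnegv ls,
      exists2 v, normal_cone X xs v &
        0 = F xs + \sum_j ls j 0 *: col j (dg xs) + v
    & forall j, ls j 0 * g xs j 0 = 0].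

(* Since 0.-1 = 0, this encodes the convention x^{-1} = x^0,
   lambda^{-1} = lambda^0 at t = 0. *)
Definition extrapolate p (theta : nat -> R) (v : nat -> 'cV[R]_p) (t : nat) :
    'cV[R]_p :=
  (1 + theta t) *: v t - theta t *: v t.-1.

Record AdOpEx_run (X : set 'cV[R]_n) (F : 'cV[R]_n -> 'cV[R]_n)
    (g : 'cV[R]_n -> 'cV[R]_m) (dg : 'cV[R]_n -> 'M[R]_(n, m))
    (eta tau theta : nat -> R)
    (x : nat -> 'cV[R]_n) (lam : nat -> 'cV[R]_m) : Prop := {
  run_x0 : X (x 0%N) ;
  run_lam0 : lam 0%N = 0 ;
  run_lam : forall t,
    let s := extrapolate theta (fun i => g (x i)) t in
    is_argmin (@nonnegv R m)
      (fun l => dotv (- s) l + tau t / 2 * enorm (l - lam t) ^+ 2)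
      (lam t.+1) ;
  run_x : forall t,
    let u := extrapolate theta (fun i => F (x i) + dg (x i) *m lam i) t in
    is_argmin X
      (fun y => dotv u y + eta t / 2 * enorm (y - x t) ^+ 2)
      (x t.+1)
}.

Definition output (gamma : nat -> R) (x : nat -> 'cV[R]_n) (T : nat) :
    'cV[R]_n :=
  (\sum_(t < T) gamma t)^-1 *: \sum_(t < T) gamma t *: x t.+1.

Definition step_beta (L Mg : R) : R := Mg ^+ 2 / (3 * L ^+ 2).

Definition step_eta (L Lg : R) (lam : nat -> 'cV[R]_m) (t : nat) : R :=
  6 * L + 6 * Lg * \big[Num.max/0]_(1 <= i < t.+1) enorm (lam i).

Definition step_gamma (eta : nat -> R) (t : nat) : R := eta 0%N / eta t.

(* gm1 is the arbitrary value of gamma_{-1}. *)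
Definition step_theta (gm1 : R) (gamma : nat -> R) (t : nat) : R :=
  (if t is s.+1 then gamma s else gm1) / gamma t.

End FCVI.

(* Main.v *)
Require Import Defs.
From HB Require Import structures.
From mathcomp Require Import all_boot all_order all_algebra.
From mathcomp Require Import all_classical all_reals all_analysis.
From mathcomp Require Import ring lra.

Import Order.TTheory GRing.Theory Num.Theory.
Import numFieldNormedType.Exports.

Local Open Scope classical_set_scope.
Local Open Scope ring_scope.

(** The iteration is a projection method for the saddle operator
    (F + sum_j lam_j grad g_j, - g), which is monotone on X times the
    nonnegative orthant because F is monotone, the g_j are convex and the
    multipliers are nonnegative ([gap_lower_bound]).  Write H for its first
    component and G for the second one along the run.

    The optimality condition of each of the two projections, multiplied by
    gamma_t, has distance terms whose weights do not depend on t, because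
    gamma_t eta_t = 6 L and gamma_t tau_t = 2 kappa with kappa = Mg^2 / L; and,
    because gamma_t theta_t = gamma_{t-1}, the extrapolation errors
    gamma_t (H_{t+1} - H_t) telescope up to a product of consecutive
    displacements ([extrapolated_prox]).  The change of H from t-1 to t is at
    most (L + Lg |lam_{t-1}|) |x_t - x_{t-1}| + Mg |lam_t - lam_{t-1}|
    ([operator_variation]), and eta_{t-1} dominates 6 (L + Lg |lam_{t-1}|), so
    after multiplication by gamma_{t-1} it is at most
    L |x_t - x_{t-1}| + Mg |lam_t - lam_{t-1}|, whatever the size of the
    multipliers.  Young's inequality then absorbs all cross terms
    ([cross_terms_le]), and the [potential] of the run decreases by at least
    the weighted gap at each step ([potential_step], [energy_estimate]).

    At a solution and its multiplier the gap is nonnegative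
    ([KKT_lagrangian_ge0]), so the energy estimate bounds the multipliers
    ([lam_bounded]).  Hence eta_t is bounded, gamma_t is bounded below by a
    positive constant, and the total weight grows at least linearly in T.
    Dividing the energy estimate by that weight, with Jensen's inequality
    ([averaged_energy]), gives both rates: the test multiplier 0 for the gap
    ([gap_rate]), and the multiplier of the solution shifted by the
    normalized violation for infeasibility ([infeasibility_rate]).  The
    maximum in the gap exists because the feasible set is compact
    ([gap_max_exists]). *)

Set Implicit Arguments.
Unset Strict Implicit.
Unset Printing Implicit Defensive.

(** * Euclidean inner product and norm *)

Section EuclideanSpace.
Context {R : realType}.
Implicit Types n m : nat.

Lemma dotvC n (u v : 'cV[R]_n) : dotv u v = dotv v u.
Proof. by apply: eq_bigr => i _; rewrite mulrC. Qed.

Lemma dotvDl n (u v w : 'cV[R]_n) : dotv (u + v) w = dotv u w + dotv v w.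
Proof. by rewrite -big_split; apply: eq_bigr => i _; rewrite mxE mulrDl. Qed.

Lemma dotvZl n a (u w : 'cV[R]_n) : dotv (a *: u) w = a * dotv u w.
Proof. by rewrite mulr_sumr; apply: eq_bigr => i _; rewrite mxE mulrA. Qed.

Lemma dotvNl n (u w : 'cV[R]_n) : dotv (- u) w = - dotv u w.
Proof. by rewrite -scaleN1r dotvZl mulN1r. Qed.

Lemma dotvDr n (w u v : 'cV[R]_n) : dotv w (u + v) = dotv w u + dotv w v.
Proof. by rewrite dotvC dotvDl !(dotvC w). Qed.

Lemma dotvZr n a (w u : 'cV[R]_n) : dotv w (a *: u) = a * dotv w u.
Proof. by rewrite dotvC dotvZl (dotvC w). Qed.

Lemma dotvNr n (w u : 'cV[R]_n) : dotv w (- u) = - dotv w u.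
Proof. by rewrite dotvC dotvNl (dotvC w). Qed.

Definition dotvE := (dotvDl, dotvDr, dotvNl, dotvNr, dotvZl, dotvZr).

Lemma dotv0 n (u : 'cV[R]_n) : dotv u 0 = 0.
Proof. by rewrite -(scale0r 0) dotvZr mul0r. Qed.

Lemma dotv_suml n (I : Type) (r : seq I) (f : I -> 'cV[R]_n) w :
  dotv (\sum_(i <- r) f i) w = \sum_(i <- r) dotv (f i) w.
Proof.
elim/big_rec2: _ => [|i s u _ <-]; last exact: dotvDl.
by rewrite dotvC dotv0.
Qed.

Lemma dotv_mulmx n m (A : 'M[R]_(n, m)) (l : 'cV[R]_m) w :
  dotv (A *m l) w = \sum_j l j 0 * dotv (col j A) w.
Proof.
transitivity (\sum_j dotv (l j 0 *: col j A) w); last first.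
  by apply: eq_bigr => j _; rewrite dotvZl.
rewrite -dotv_suml; congr dotv; apply/colP => i.
by rewrite mxE summxE; apply: eq_bigr => j _; rewrite !mxE mulrC.
Qed.

Lemma dotvv_ge0 n (u : 'cV[R]_n) : 0 <= dotv u u.
Proof. by apply: sumr_ge0 => i _; rewrite -expr2 sqr_ge0. Qed.

Lemma enorm_ge0 n (u : 'cV[R]_n) : 0 <= enorm u.
Proof. exact: sqrtr_ge0. Qed.

Lemma sqr_enorm n (u : 'cV[R]_n) : enorm u ^+ 2 = dotv u u.
Proof. by rewrite sqr_sqrtr ?dotvv_ge0. Qed.

Lemma enorm_le n (u : 'cV[R]_n) k : 0 <= k -> dotv u u <= k ^+ 2 -> enorm u <= k.
Proof.
by move=> k0 uk; rewrite -(@ler_pXn2r _ 2) ?nnegrE ?enorm_ge0// sqr_enorm.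
Qed.

Lemma enorm0 n : enorm (0 : 'cV[R]_n) = 0.
Proof. by rewrite /enorm dotv0 sqrtr0. Qed.

Lemma enormN n (u : 'cV[R]_n) : enorm (- u) = enorm u.
Proof. by rewrite /enorm dotvNl dotvNr opprK. Qed.

Lemma enormZ n a (u : 'cV[R]_n) : enorm (a *: u) = `|a| * enorm u.
Proof. by rewrite -sqrtr_sqr -sqrtrM ?sqr_ge0// /enorm dotvZr dotvZl mulrA. Qed.

Lemma enormBC n (u v : 'cV[R]_n) : enorm (u - v) = enorm (v - u).
Proof. by rewrite -enormN opprB. Qed.

Lemma enorm_eq0 n (u : 'cV[R]_n) : enorm u = 0 -> u = 0.
Proof.
move=> u0; have : dotv u u = 0 by rewrite -sqr_enorm u0 expr0n.
move=> /psumr_eq0P ui; apply/colP => i; rewrite mxE; apply/eqP.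
rewrite -[_ == 0]orbb -mulf_eq0 ui// => j _.
by rewrite -expr2 sqr_ge0.
Qed.

(** The square of [|v| u - |u| v] is nonnegative. *)
Lemma dotv_le_enorm n (u v : 'cV[R]_n) : dotv u v <= enorm u * enorm v.
Proof.
have [/enorm_eq0 ->|u0] := eqVneq (enorm u) 0.
  by rewrite dotvC dotv0 enorm0 mul0r.
have [/enorm_eq0 ->|v0] := eqVneq (enorm v) 0.
  by rewrite dotv0 enorm0 mulr0.
have uv0 : 0 < enorm u * enorm v by rewrite mulr_gt0// lt0r ?u0 ?v0 enorm_ge0.
have := dotvv_ge0 (enorm v *: u - enorm u *: v).
rewrite !dotvE -!sqr_enorm (dotvC v u) => h.
rewrite -subr_ge0 -(pmulr_lge0 _ uv0); nra.
Qed.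

Lemma dotv_ge_enorm n (u v : 'cV[R]_n) : - (enorm u * enorm v) <= dotv u v.
Proof. by rewrite lerNl -dotvNl -[enorm u]enormN dotv_le_enorm. Qed.

Lemma normr_dotv n (u v : 'cV[R]_n) : `|dotv u v| <= enorm u * enorm v.
Proof. by rewrite ler_norml dotv_ge_enorm dotv_le_enorm. Qed.

Lemma enormD n (u v : 'cV[R]_n) : enorm (u + v) <= enorm u + enorm v.
Proof.
apply: enorm_le; first by rewrite addr_ge0 ?enorm_ge0.
rewrite !dotvE -!sqr_enorm (dotvC v u).
have := dotv_le_enorm u v; nra.
Qed.

Lemma enorm_dist n (u v : 'cV[R]_n) : `|enorm u - enorm v| <= enorm (u - v).
Proof.
have := enormD (u - v) v; have := enormD (v - u) u.
by rewrite !subrK (enormBC v) ler_norml => *; apply/andP; split; lra.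
Qed.

Lemma l2agg_ge0 m (c : 'I_m -> R) : 0 <= l2agg c.
Proof. exact: sqrtr_ge0. Qed.

Lemma sum_norm_mul_le m (c : 'I_m -> R) (l : 'cV[R]_m) :
  \sum_j `|l j 0| * c j <= enorm l * l2agg c.
Proof.
have := dotv_le_enorm (\col_j `|l j 0|) (\col_j c j).
congr (_ <= _ * _).
- by apply: eq_bigr => j _; rewrite !mxE.
- by congr Num.sqrt; apply: eq_bigr => j _; rewrite !mxE -normrM -!expr2 ger0_norm ?sqr_ge0.
- by congr Num.sqrt; apply: eq_bigr => j _; rewrite !mxE expr2.
Qed.

(** An operator norm bound from bounds on the columns; [k] is a distance when
    [A] is a difference of Jacobians, and 1 when [A] is a Jacobian. *)
Lemma enorm_mulmx_le n m (A : 'M[R]_(n, m)) (c : 'I_m -> R) k l : 0 <= k ->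
  (forall j, enorm (col j A) <= c j * k) ->
  enorm (A *m l) <= l2agg c * k * enorm l.
Proof.
move=> k0 Ac; set w := A *m l.
have [->|w0] := eqVneq (enorm w) 0.
  by rewrite !mulr_ge0 ?l2agg_ge0 ?enorm_ge0.
have {}w0 : 0 < enorm w by rewrite lt0r w0 enorm_ge0.
rewrite -(ler_pM2r w0) -expr2 sqr_enorm {1}/w dotv_mulmx.
apply: (@le_trans _ _ (\sum_j `|l j 0| * c j * (k * enorm w))).
  apply: ler_sum => j _; rewrite (le_trans (ler_norm _))// normrM -mulrA.
  rewrite ler_wpM2l// (le_trans (normr_dotv _ _))// mulrA.
  by rewrite ler_wpM2r ?enorm_ge0.
rewrite -mulr_suml (mulrC (l2agg c * k)) [X in _ <= X * _]mulrA -[X in _ <= X]mulrA.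
by rewrite ler_wpM2r ?sum_norm_mul_le// mulr_ge0 ?enorm_ge0.
Qed.

Lemma enorm_coord_le n (u : 'cV[R]_n) (c : 'I_n -> R) k : 0 <= k ->
  (forall j, `|u j 0| <= c j * k) -> enorm u <= l2agg c * k.
Proof.
move=> k0 uc; apply: enorm_le; first by rewrite mulr_ge0 ?l2agg_ge0.
rewrite exprMn sqr_sqrtr ?sumr_ge0// => [|j _]; last exact: sqr_ge0.
rewrite mulr_suml; apply: ler_sum => j _.
rewrite -exprMn -expr2 -real_normK ?num_real//.
by rewrite ler_pXn2r ?nnegrE// (le_trans _ (uc j)).
Qed.

End EuclideanSpace.

(** * The Euclidean norm and compactness *)

Section Topology.
Context {R : realType} {n : nat}.
Implicit Types (A : set 'cV[R]_n) (p : 'cV[R]_n).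

Lemma near_enorm p e : 0 < e -> \forall y \near p, enorm (y - p) <= e.
Proof.
move=> e0; have n0 : 0 < n%:R + 1 :> R by rewrite ltr_wpDl.
apply/nbhs_ballP; exists (e / (n%:R + 1)) => /=; first exact: divr_gt0.
move=> y [_ py]; apply: enorm_le; first exact: ltW.
apply: (@le_trans _ _ (\sum_(i < n) (e / (n%:R + 1)) ^+ 2)).
  apply: ler_sum => i _; rewrite -expr2 -real_normK ?num_real//.
  have := py i 0; rewrite -ball_normE/= distrC !mxE => /ltW h.
  by rewrite ler_pXn2r ?nnegrE// divr_ge0// ltW.
rewrite sumr_const card_ord -[_ *+ n]mulr_natl expr_div_n mulrCA ger_pMr ?exprn_gt0//.
rewrite ler_pdivrMr ?exprn_gt0// mul1r.
have := ler0n R n; nra.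
Qed.

(** The constant [K] may depend on [p], as it does for the gap function. *)
Lemma within_continuous_enorm A (f : 'cV[R]_n -> R) :
  (forall p, A p -> exists K, forall y, A y -> `|f y - f p| <= K * enorm (y - p)) ->
  {within A, continuous f}.
Proof.
move=> fA; apply/subspace_continuousP => p Ap; have [K fK] := fA _ Ap.
apply/cvgrPdist_le => e e0.
have K1 : 0 < `|K| + 1 by rewrite ltr_wpDl.
rewrite near_withinE; have := near_enorm p (divr_gt0 e0 K1).
apply: filterS => y yp Ay; rewrite distrC (le_trans (fK _ Ay))//.
apply: (@le_trans _ _ ((`|K| + 1) * enorm (y - p))).
  by rewrite ler_wpM2r ?enorm_ge0// (le_trans (ler_norm _))// lerDl.
by rewrite mulrC -ler_pdivlMr.
Qed.

Lemma compact_enorm_bounded A : compact A -> exists B, forall y, A y -> enorm y <= B.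
Proof.
move=> cA; have [[p Ap]|A0] := pselect (A !=set0); last first.
  by exists 0 => y Ay; case: A0; exists y.
have [|c _ cmax] := @compact_EVT_max _ R (@enorm R n) A (ex_intro _ p Ap) cA.
  apply: within_continuous_enorm => z _; exists 1 => y _.
  by rewrite mul1r enorm_dist.
by exists (enorm c) => y /mem_set/cmax.
Qed.

End Topology.

(** * Convexity, projection steps and weighted averages *)

Section Convexity.
Context {R : realType} {n : nat}.
Implicit Types (D : set 'cV[R]_n) (f : 'cV[R]_n -> R) (p y v : 'cV[R]_n).

Lemma convex_set_comb D p y s : convex_set D -> D p -> D y -> 0 <= s -> s <= 1 ->
  D (s *: p + (1 - s) *: y).
Proof.
move=> cD Dp Dy s0 s1; have ss : Itv.spec (@Itv.num_sem R) (Itv.Real `[0%Z, 1%Z]) s.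
  by rewrite /= /Itv.num_sem/= in_itv/= s0 s1 num_real.
have := cD p y (Itv.mk ss); rewrite !inE; exact.
Qed.

Lemma convex_function_comb D f p y s : convex_function D f -> D p -> D y ->
  0 <= s -> s <= 1 ->
  f (s *: p + (1 - s) *: y) <= s * f p + (1 - s) * f y.
Proof.
move=> cf Dp Dy s0 s1; have ss : Itv.spec (@Itv.num_sem R) (Itv.Real `[0%Z, 1%Z]) s.
  by rewrite /= /Itv.num_sem/= in_itv/= s0 s1 num_real.
by have := cf (Itv.mk ss) p y (mem_set Dp) (mem_set Dy).
Qed.

Lemma convex_function_of_comb D f :
  (forall s p y, D p -> D y -> 0 <= s -> s <= 1 ->
    f (s *: p + (1 - s) *: y) <= s * f p + (1 - s) * f y) ->
  convex_function D f.
Proof. by move=> cf s p y /set_mem Dp /set_mem Dy; exact: cf. Qed.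

Lemma comb_segment s p y : s *: y + (1 - s) *: p = p + s *: (y - p).
Proof. by rewrite scalerBl scale1r scalerBr addrCA. Qed.

(** Convexity bounds the increment of [f] over the fraction [s] of the segment
    by [s (f y - f p)], the expansion at [p] makes it [s <v, y - p>] up to a
    small multiple of [s]; divide by [s]. *)
Lemma convex_gradient_le D f p v y : convex_set D -> convex_function D f ->
  gradient_on D f p v -> D p -> D y -> dotv v (y - p) <= f y - f p.
Proof.
move=> cD cf /eqoP gf Dp Dy; apply/ler_addgt0Pr => e e0.
have K1 : 0 < enorm (y - p) + 1 by rewrite ltr_wpDl ?enorm_ge0.
have d0 : 0 < e / (enorm (y - p) + 1) by rewrite divr_gt0.
have := gf _ d0; rewrite near_withinE => /nbhs_ballP[r /= r0 pr].
have r1 : 0 < `|y - p| + 1 by rewrite ltr_wpDl.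
(* The ball is for the sup norm; [s] keeps the point inside it. *)
pose s := Num.min 1 (r / 2 / (`|y - p| + 1)).
have s0 : 0 < s by rewrite lt_min ltr01 !divr_gt0.
have s1 : s <= 1 by rewrite ge_min lexx.
have := convex_function_comb cf Dy Dp (ltW s0) s1.
have := convex_set_comb cD Dy Dp (ltW s0) s1; rewrite comb_segment => Dz fz.
have /pr/(_ Dz)/= : ball p r (p + s *: (y - p)).
  rewrite -ball_normE/= opprD addNKr normrN normrZ gtr0_norm//.
  apply: (@le_lt_trans _ _ (r / 2)); last by rewrite ltr_pdivrMr// ltr_pMr// ltr1n.
  apply: (@le_trans _ _ (s * (`|y - p| + 1))).
    by rewrite ler_wpM2l ?(ltW s0)// lerDl.
  by rewrite -ler_pdivlMr// ge_min lexx orbT.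
have -> : p + s *: (y - p) - p = s *: (y - p) by rewrite addrAC subrr add0r.
rewrite dotvZr.
rewrite enormZ (gtr0_norm s0).
rewrite (ger0_norm (mulr_ge0 (ltW s0) (enorm_ge0 _))) ler_norml => /andP[h _].
have : e / (enorm (y - p) + 1) * (s * enorm (y - p)) <= e * s.
  rewrite mulrAC -[X in X <= _]mulrA ler_pM2l// ler_pdivrMr//.
  by rewrite ler_wpM2l ?(ltW s0)// lerDl.
move=> h2; rewrite -(ler_pM2l s0); lra.
Qed.

(** First-order optimality: move from [p] towards [y] by [s] and let [s]
    go to 0; the polarization identity turns the result into the usual
    three-point form. *)
Lemma prox_three_point D (u a p : 'cV[R]_n) e y : convex_set D -> 0 <= e ->
  is_argmin D (fun z => dotv u z + e / 2 * enorm (z - a) ^+ 2) p -> D y ->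
  dotv u (p - y) <=
    e / 2 * (enorm (a - y) ^+ 2 - enorm (p - y) ^+ 2 - enorm (p - a) ^+ 2).
Proof.
move=> cD e0 [Dp pmin] Dy.
suff h : 0 <= dotv u (y - p) + e * dotv (p - a) (y - p).
  move: h; rewrite !sqr_enorm !dotvE !(dotvC y) !(dotvC a p); lra.
apply/ler_addgt0Pr => d d0.
set q := e / 2 * dotv (y - p) (y - p).
have q0 : 0 <= q by rewrite mulr_ge0 ?dotvv_ge0 ?divr_ge0.
have q1 : 0 < q + 1 by rewrite ltr_wpDl.
pose s := Num.min 1 (d / (q + 1)).
have s0 : 0 < s by rewrite lt_min ltr01 divr_gt0.
have s1 : s <= 1 by rewrite ge_min lexx.
have sq : s * q <= d.
  apply: (@le_trans _ _ (s * (q + 1))); first by rewrite ler_wpM2l ?(ltW s0)// lerDl.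
  by rewrite -ler_pdivlMr// ge_min lexx orbT.
have := pmin _ (convex_set_comb cD Dy Dp (ltW s0) s1).
rewrite comb_segment addrAC !sqr_enorm => h.
rewrite -(pmulr_rge0 _ s0).
have {}h : 0 <= s * (dotv u (y - p) + e * dotv (p - a) (y - p)) + s * (s * q).
  move: h; rewrite /q !dotvE !(dotvC y) !(dotvC a); lra.
by rewrite mulrDr (le_trans h)// lerD2l ler_pM2l.
Qed.

(** Splitting the extrapolated value as [h t.+1 - (h t.+1 - h t) +
    theta t (h t - h t.-1)] leaves the operator at the new point, two error
    terms that telescope over [t], and one against the last displacement. *)
Lemma extrapolated_prox D (theta : nat -> R) (h z : nat -> 'cV[R]_n) e t y :
  convex_set D -> 0 <= e ->
  is_argmin D (fun w => dotv (extrapolate theta h t) w + e / 2 * enorm (w - z t) ^+ 2)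
    (z t.+1) -> D y ->
  dotv (h t.+1) (z t.+1 - y) <=
    e / 2 * (enorm (z t - y) ^+ 2 - enorm (z t.+1 - y) ^+ 2
             - enorm (z t.+1 - z t) ^+ 2)
    + dotv (h t.+1 - h t) (z t.+1 - y)
    - theta t * dotv (h t - h t.-1) (z t - y)
    - theta t * dotv (h t - h t.-1) (z t.+1 - z t).
Proof.
move=> cD e0 hz Dy; have := prox_three_point cD e0 hz Dy.
rewrite /extrapolate !dotvE; lra.
Qed.

End Convexity.

Section Average.
Context {R : realType} {n : nat}.

(** Induction on [T]: one more iterate replaces the average by a convex
    combination of it with that iterate. *)
Lemma output_mem_jensen (D : set 'cV[R]_n) (w : nat -> R) (x : nat -> 'cV[R]_n) T :
  convex_set D -> (forall t, 0 < w t) -> (forall t, D (x t)) -> (0 < T)%N ->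
  D (output w x T) /\
  forall f : 'cV[R]_n -> R, convex_function D f ->
    (\sum_(t < T) w t) * f (output w x T) <= \sum_(t < T) w t * f (x t.+1).
Proof.
move=> cD w0 Dx; case: T => // T _; elim: T => [|T [Do IH]].
  rewrite /output !big_ord1 scalerA mulVf ?gt_eqF// scale1r.
  by split=> // f _; rewrite big_ord1.
have W0 k : 0 < \sum_(t < k.+1) w t.
  by rewrite big_ord_recr/= ltr_wpDl// sumr_ge0// => i _; exact: ltW.
set W := \sum_(t < T.+1) w t in Do IH; have W1 : 0 < W by exact: W0.
have WS : \sum_(t < T.+2) w t = W + w T.+1 by rewrite big_ord_recr.
have W2 : 0 < W + w T.+1 by rewrite addr_gt0.
pose s := W / (W + w T.+1).
have s1E : 1 - s = w T.+1 / (W + w T.+1).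
  by apply: (mulIf (lt0r_neq0 W2)); rewrite mulrBl /s !divfK ?gt_eqF// mul1r addrAC subrr add0r.
have s0 : 0 <= s by rewrite divr_ge0 ?ltW.
have s1 : s <= 1 by rewrite -subr_ge0 s1E divr_ge0 ?ltW.
have oE : output w x T.+2 = s *: output w x T.+1 + (1 - s) *: x T.+2.
  rewrite s1E /output WS big_ord_recr/= scalerDr -/W !scalerA.
  congr (_ *: _ + _ *: _); last by rewrite mulrC.
  by rewrite /s mulrAC mulfV ?gt_eqF// mul1r.
rewrite oE WS; split=> [|f cf]; first exact: convex_set_comb.
have := convex_function_comb cf Do (Dx T.+2) s0 s1.
rewrite -(ler_pM2l W2) => /le_trans; apply.
have sW : (W + w T.+1) * s = W by rewrite mulrC divfK ?gt_eqF.
have s1W : (W + w T.+1) * (1 - s) = w T.+1 by rewrite s1E mulrC divfK ?gt_eqF.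
rewrite big_ord_recr/= mulrDr (mulrA _ s) sW (mulrA _ (1 - s)) s1W.
by rewrite lerD2r; exact: IH.
Qed.

End Average.

(** * The constrained variational inequality *)

Section Problem.
Context {R : realType} {n m : nat}.
Context {X : set 'cV[R]_n} {F : 'cV[R]_n -> 'cV[R]_n}.
Context {g : 'cV[R]_n -> 'cV[R]_m} {dg : 'cV[R]_n -> 'M[R]_(n, m)}.
Context {L : R} {Mg Lg : 'I_m -> R}.
Hypothesis P : smooth_FCVI X F g dg L Mg Lg.

Lemma convex_nonnegv : convex_set (@nonnegv R m).
Proof.
move=> u v s; rewrite !inE => u0 v0 i.
by rewrite !mxE addr_ge0// mulr_ge0// subr_ge0.
Qed.

Lemma g_enorm_lipschitz y z : X y -> X z ->
  enorm (g y - g z) <= l2agg Mg * enorm (y - z).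
Proof.
move=> Xy Xz; apply: enorm_coord_le; first exact: enorm_ge0.
by move=> j; rewrite !mxE; exact: FCVI_g_lipschitz P _ _ _ Xy Xz.
Qed.

Lemma g_gradient_le j y z : X y -> X z ->
  dotv (col j (dg y)) (z - y) <= g z j 0 - g y j 0.
Proof.
move=> Xy Xz; apply: (convex_gradient_le (FCVI_convex_set P)
  (FCVI_convex_fun P j) (FCVI_gradient P j Xy) Xy Xz).
Qed.

(** Split the change of [dg *m lam] into the change of [dg] at the earlier
    multiplier [l] and the change of multiplier at the later point [z]: this
    way the step size has to dominate the norm of [l] only. *)
Lemma operator_variation y z (l k : 'cV[R]_m) : X y -> X z ->
  enorm (F z + dg z *m k - (F y + dg y *m l)) <=
    (L + l2agg Lg * enorm l) * enorm (z - y) + l2agg Mg * enorm (k - l).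
Proof.
move=> Xy Xz.
have -> : F z + dg z *m k - (F y + dg y *m l) =
    F z - F y + (dg z - dg y) *m l + dg z *m (k - l).
  rewrite mulmxBl mulmxBr; apply/colP => i; rewrite !mxE; ring.
apply: (le_trans (enormD _ _)); apply: lerD.
  apply: (le_trans (enormD _ _)); rewrite mulrDl; apply: lerD.
    exact: FCVI_lipschitz P _ _ Xz Xy.
  rewrite mulrAC; apply: enorm_mulmx_le; first exact: enorm_ge0.
  by move=> j; rewrite linearB; exact: FCVI_gradient_lipschitz P j _ _ Xz Xy.
rewrite -[l2agg Mg]mulr1; apply: enorm_mulmx_le; first exact: ler01.
by move=> j; rewrite mulr1; exact: FCVI_gradient_bound P j _ Xz.
Qed.

(** The saddle operator is monotone: monotonicity of [F] and convexity of
    the constraints, weighted by the nonnegative multipliers [k]. *)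
Lemma gap_lower_bound y z (l k : 'cV[R]_m) : X y -> X z -> nonnegv k ->
  dotv (F y) (z - y) - dotv k (g y) + dotv l (g z) <=
  dotv (F z + dg z *m k) (z - y) + dotv (- g z) (k - l).
Proof.
move=> Xy Xz k0.
have h1 : dotv (F y) (z - y) <= dotv (F z) (z - y).
  by rewrite -subr_ge0 -dotvNl -dotvDl; exact: FCVI_monotone P _ _ Xz Xy.
have h2 : dotv k (g z) - dotv k (g y) <= dotv (dg z *m k) (z - y).
  rewrite -dotvNr -dotvDr dotv_mulmx; apply: ler_sum => j _.
  rewrite ler_wpM2l// !mxE -[z - y]opprB dotvNr -[_ - _]opprB lerN2.
  exact: g_gradient_le.
have -> : dotv (- g z) (k - l) = dotv l (g z) - dotv k (g z).
  by rewrite dotvNl dotvDr dotvNr !(dotvC (g z)) opprB.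
by rewrite dotvDl; lra.
Qed.

(** [g] is continuous on [X] only, so its sublevel sets need not be closed;
    the feasible set is closed relatively to [X], and [X] is compact. *)
Lemma compact_feasible : compact (feasible X g).
Proof.
suff -> : feasible X g = X `&` closure (feasible X g).
  exact: compact_closedI (FCVI_compact P) (@closed_closure _ _).
apply/seteqP; split=> [y fy|y [Xy cly]]; first by split; [case: fy|exact: subset_closure].
split=> // j; apply/ler_addgt0Pr => e e0; rewrite add0r.
have M1 : 0 < `|Mg j| + 1 by rewrite ltr_wpDl.
have [z [[Xz gz] yz]] := cly _ (near_enorm y (divr_gt0 e0 M1)).
have := FCVI_g_lipschitz P j Xz Xy.
rewrite ler_norml => /andP[+ _]; have := gz j.
suff : Mg j * enorm (z - y) <= e by lra.
rewrite /= ler_pdivlMr// in yz; apply: le_trans yz.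
by rewrite mulrC ler_wpM2l ?enorm_ge0// (le_trans (ler_norm _))// lerDl.
Qed.

Lemma gap_max_exists z : feasible X g !=set0 ->
  exists2 y, feasible X g y &
    is_max [set dotv (F w) (z - w) | w in feasible X g] (dotv (F y) (z - y)).
Proof.
move=> f0; have [B XB] := compact_enorm_bounded (FCVI_compact P).
have [|y /set_mem fy ymax] := @compact_EVT_max _ R (fun w => dotv (F w) (z - w))
    _ f0 compact_feasible; last first.
  by exists y => //; split=> [|_ [w fw <-]]; [exists y|exact/ymax/mem_set].
apply: within_continuous_enorm => p [Xp _].
exists (L * (enorm z + B) + enorm (F p)) => y [Xy _].
have -> : dotv (F y) (z - y) - dotv (F p) (z - p) =
    dotv (F y - F p) (z - y) + dotv (F p) (p - y) by rewrite !dotvE; lra.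
rewrite mulrDl (le_trans (ler_normD _ _))// lerD//; last first.
  by rewrite (le_trans (normr_dotv _ _))// enormBC.
rewrite (le_trans (normr_dotv _ _))// mulrAC.
apply: ler_pM; rewrite ?enorm_ge0//; first exact: FCVI_lipschitz P _ _ Xy Xp.
by rewrite (le_trans (enormD _ _))// enormN lerD2l XB.
Qed.

Lemma KKT_lagrangian_ge0 xs ls z : X xs -> KKT X F g dg xs ls -> X z ->
  0 <= dotv (F xs) (z - xs) + dotv ls (g z).
Proof.
move=> Xxs [ls0 [v vN /(congr1 (fun u => dotv u (z - xs))) h] comp] Xz.
move: h; rewrite /= (dotvC 0) dotv0 !dotvDl dotv_suml => h.
have := vN _ Xz; suff : \sum_j dotv (ls j 0 *: col j (dg xs)) (z - xs) <= dotv ls (g z).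
  by lra.
apply: ler_sum => j _; rewrite dotvZl.
rewrite -[leRHS]subr0 -(comp j) -mulrBr ler_wpM2l//.
exact: g_gradient_le.
Qed.

Lemma lagrangian_convex y l : nonnegv l ->
  convex_function X (fun z => dotv (F y) (z - y) + dotv l (g z)).
Proof.
move=> l0; apply: convex_function_of_comb => s p q Xp Xq s0 s1.
have : dotv l (g (s *: p + (1 - s) *: q)) <=
    s * dotv l (g p) + (1 - s) * dotv l (g q).
  rewrite -!dotvZr -dotvDr; apply: ler_sum => j _; rewrite ler_wpM2l// !mxE.
  exact: convex_function_comb (FCVI_convex_fun P j) Xp Xq s0 s1.
rewrite !dotvE; lra.
Qed.

End Problem.

(** * Convergence of the run *)

Section Run.
Context {R : realType} {n m : nat}.
Context {X : set 'cV[R]_n} {F : 'cV[R]_n -> 'cV[R]_n}.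
Context {g : 'cV[R]_n -> 'cV[R]_m} {dg : 'cV[R]_n -> 'M[R]_(n, m)}.
Context {L : R} {Mg Lg : 'I_m -> R}.
Context {x : nat -> 'cV[R]_n} {lam : nat -> 'cV[R]_m} {gm1 : R}.
Let eta := step_eta L (l2agg Lg) lam.
Let tau t := step_beta L (l2agg Mg) * eta t.
Let gamma := step_gamma eta.
Let theta := step_theta gm1 gamma.
Hypothesis P : smooth_FCVI X F g dg L Mg Lg.
Hypothesis run : AdOpEx_run X F g dg eta tau theta x lam.

Let M := l2agg Mg.
Let kappa := M ^+ 2 / L.

Let L0 : 0 < L. Proof. exact: FCVI_L_gt0 P. Qed.
Let M0 : 0 < M. Proof. exact: FCVI_Mg_gt0 P. Qed.
Let kappa_gt0 : 0 < kappa. Proof. by rewrite divr_gt0 ?exprn_gt0. Qed.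

Lemma run_mem t : X (x t).
Proof. by case: t => [|t]; [exact: run_x0 run|case: (run_x run t)]. Qed.

Lemma lam_nonneg t : nonnegv (lam t).
Proof.
case: t => [i|t]; last by case: (run_lam run t).
by rewrite (run_lam0 run) mxE.
Qed.

Lemma eta_ge t : 6 * (L + l2agg Lg * enorm (lam t)) <= eta t.
Proof.
rewrite mulrDr mulrA lerD2l ler_wpM2l ?mulr_ge0 ?l2agg_ge0//.
case: t => [|t]; first by rewrite (run_lam0 run) enorm0 big_geq.
apply: (le_bigmax_seq 0 t.+1 xpredT (fun i => enorm (lam i))) => //.
by rewrite mem_index_iota ltnSn.
Qed.

Lemma eta_geL t : 6 * L <= eta t.
Proof.
apply: le_trans (eta_ge t); rewrite ler_pM2l// lerDl.
by rewrite mulr_ge0 ?l2agg_ge0 ?enorm_ge0.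
Qed.

Lemma eta_gt0 t : 0 < eta t.
Proof. by apply: lt_le_trans (eta_geL t); rewrite mulr_gt0. Qed.

Lemma eta0E : eta 0 = 6 * L.
Proof. by rewrite /eta /step_eta big_geq// mulr0 addr0. Qed.

Lemma gamma_gt0 t : 0 < gamma t.
Proof. by rewrite divr_gt0 ?eta_gt0. Qed.

Lemma gamma_le1 t : gamma t <= 1.
Proof. by rewrite ler_pdivrMr ?eta_gt0// mul1r eta0E eta_geL. Qed.

Lemma gamma_eta t : gamma t * eta t = 6 * L.
Proof. by rewrite divfK ?eta0E// gt_eqF ?eta_gt0. Qed.

Lemma gamma_tau t : gamma t * tau t = 2 * kappa.
Proof.
rewrite mulrCA gamma_eta /step_beta /kappa -/M; field.
by rewrite gt_eqF.
Qed.

Lemma gamma_theta t : gamma t.+1 * theta t.+1 = gamma t.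
Proof. by rewrite mulrC divfK// gt_eqF ?gamma_gt0. Qed.

Let H t := F (x t) + dg (x t) *m lam t.
Let G t := - g (x t).
Let d t := enorm (x t - x t.-1).
Let e t := enorm (lam t - lam t.-1).

(** The adaptive step size cancels the norm of the multiplier. *)
Lemma gamma_H_variation t :
  gamma t.-1 * enorm (H t - H t.-1) <= L * d t + M * e t.
Proof.
have g0 := gamma_gt0 t.-1.
have := operator_variation P (lam t.-1) (lam t) (run_mem t.-1) (run_mem t).
rewrite -/(H t) -/(H t.-1) -/(d t) -/(e t) -(ler_pM2l g0) => /le_trans; apply.
rewrite mulrDr mulrA lerD//.
  rewrite ler_wpM2r ?enorm_ge0// -(ler_pM2l (_ : 0 < 6 :> R))//.
  by rewrite -(gamma_eta t.-1) mulrCA ler_pM2l ?eta_ge.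
by rewrite ler_piMl ?gamma_le1// mulr_ge0 ?enorm_ge0// ltW.
Qed.

Lemma gamma_G_variation t : gamma t.-1 * enorm (G t - G t.-1) <= M * d t.
Proof.
rewrite (_ : G t - G t.-1 = g (x t.-1) - g (x t)); last by rewrite opprK addrC.
apply: (@le_trans _ _ (enorm (g (x t.-1) - g (x t)))).
  by rewrite ler_piMl ?gamma_le1 ?enorm_ge0.
by rewrite /d enormBC; exact: g_enorm_lipschitz P _ _ (run_mem _) (run_mem _).
Qed.

Lemma H_cross_le t v : gamma t.-1 * - dotv (H t - H t.-1) v <=
  (L * d t + M * e t) * enorm v.
Proof.
apply: le_trans (ler_wpM2r (enorm_ge0 v) (gamma_H_variation t)).
by rewrite -[leRHS]mulrA ler_pM2l ?gamma_gt0// lerNl dotv_ge_enorm.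
Qed.

Lemma G_cross_le t v : gamma t.-1 * - dotv (G t - G t.-1) v <= M * d t * enorm v.
Proof.
apply: le_trans (ler_wpM2r (enorm_ge0 v) (gamma_G_variation t)).
by rewrite -[leRHS]mulrA ler_pM2l ?gamma_gt0// lerNl dotv_ge_enorm.
Qed.

(** Young's inequality, weighted so that [d1] and [d2] each get half of the
    coefficient [3 L] that the projection step provides. *)
Lemma cross_terms_le d1 d2 e1 e2 :
  (L * d1 + M * e1) * d2 + M * d1 * e2 <=
  3 / 2 * L * d1 ^+ 2 + 3 / 4 * kappa * e1 ^+ 2
  + 3 / 2 * L * d2 ^+ 2 + kappa / 4 * e2 ^+ 2.
Proof.
have -> : M = M / L * L by rewrite divfK// gt_eqF.
have -> : kappa = L * (M / L) ^+ 2 by rewrite /kappa; field; rewrite gt_eqF.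
set r := M / L; rewrite -subr_ge0.
rewrite (_ : _ - _ = L * ((d1 - d2) ^+ 2 / 2 + (d2 - r * e1 / 2) ^+ 2
  + (d1 - r * e2 / 2) ^+ 2 + (r * e1) ^+ 2 / 2)); last by field.
by rewrite mulr_ge0 ?(ltW L0)// !addr_ge0 ?divr_ge0 ?sqr_ge0.
Qed.

Let gap t y l := dotv (H t.+1) (x t.+1 - y) + dotv (G t.+1) (lam t.+1 - l).

(** The last bracket keeps the part of the squared displacements that pays for
    the cross terms of the next step. *)
Let potential t y l :=
  3 * L * enorm (x t - y) ^+ 2 + kappa * enorm (lam t - l) ^+ 2
  - gamma t.-1 * (dotv (H t - H t.-1) (x t - y) + dotv (G t - G t.-1) (lam t - l))
  + (3 / 2 * L * d t ^+ 2 + 3 / 4 * kappa * e t ^+ 2).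


(** At [t = 0], where [theta] is arbitrary, the difference is zero. *)
Lemma gamma_theta_dotv p (h : nat -> 'cV[R]_p) v t :
  gamma t * (theta t * dotv (h t - h t.-1) v) =
  gamma t.-1 * dotv (h t - h t.-1) v.
Proof.
case: t => [|t]; last by rewrite mulrA gamma_theta.
by rewrite subrr (dotvC 0) dotv0 !mulr0.
Qed.

Lemma potential_step t y l : X y -> nonnegv l ->
  gamma t * gap t y l + potential t.+1 y l <= potential t y l.
Proof.
move=> Xy l0; have g0 := ltW (gamma_gt0 t).
have tau0 : 0 <= tau t.
  rewrite !mulr_ge0 ?invr_ge0 ?exprn_ge0 ?l2agg_ge0 ?(ltW (eta_gt0 t))//.
  by rewrite ltW// mulr_gt0// exprn_gt0.
have px := extrapolated_prox (FCVI_convex_set P) (ltW (eta_gt0 t)) (run_x run t) Xy.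
have sE : - extrapolate theta (fun i => g (x i)) t = extrapolate theta G t.
  by rewrite /extrapolate /G !scalerN opprB opprK addrC.
have := run_lam run t; rewrite /= sE => runl.
have pl := extrapolated_prox convex_nonnegv tau0 runl l0.
have {}px := ler_wpM2l g0 px; have {}pl := ler_wpM2l g0 pl.
rewrite -/(H t) -/(H t.+1) -/(H t.-1) -/(d t.+1) in px; rewrite -/(e t.+1) in pl.
have {}px : gamma t * dotv (H t.+1) (x t.+1 - y) <=
    3 * L * (enorm (x t - y) ^+ 2 - enorm (x t.+1 - y) ^+ 2 - d t.+1 ^+ 2)
    + gamma t * dotv (H t.+1 - H t) (x t.+1 - y)
    - gamma t.-1 * dotv (H t - H t.-1) (x t - y)
    - gamma t.-1 * dotv (H t - H t.-1) (x t.+1 - x t).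
  apply: le_trans px _; rewrite le_eqVlt; apply/orP; left; apply/eqP.
  rewrite -!gamma_theta_dotv (_ : 3 * L = gamma t * eta t / 2); last by rewrite gamma_eta; field.
  by rewrite /d /=; field.
have {}pl : gamma t * dotv (G t.+1) (lam t.+1 - l) <=
    kappa * (enorm (lam t - l) ^+ 2 - enorm (lam t.+1 - l) ^+ 2 - e t.+1 ^+ 2)
    + gamma t * dotv (G t.+1 - G t) (lam t.+1 - l)
    - gamma t.-1 * dotv (G t - G t.-1) (lam t - l)
    - gamma t.-1 * dotv (G t - G t.-1) (lam t.+1 - lam t).
  apply: le_trans pl _; rewrite le_eqVlt; apply/orP; left; apply/eqP.
  rewrite -!gamma_theta_dotv (_ : kappa = gamma t * tau t / 2); last by rewrite gamma_tau; field.
  by rewrite /e /=; field.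
have hx := H_cross_le t (x t.+1 - x t); have hl := G_cross_le t (lam t.+1 - lam t).
rewrite -/(d t.+1) in hx; rewrite -/(e t.+1) in hl.
have := cross_terms_le (d t) (d t.+1) (e t) (e t.+1).
rewrite /gap /potential /=; lra.
Qed.

(** The error terms still pending at time [t] cost at most part of the
    distances. *)
Lemma potential_ge t y l : kappa / 2 * enorm (lam t - l) ^+ 2 <= potential t y l.
Proof.
have hx := H_cross_le t (- (x t - y)); have hl := G_cross_le t (- (lam t - l)).
rewrite dotvNr (opprK (dotv _ _)) enormN in hx.
rewrite dotvNr (opprK (dotv _ _)) enormN in hl.
have := cross_terms_le (d t) (enorm (x t - y)) (e t) (enorm (lam t - l)).
have : 0 <= L * enorm (x t - y) ^+ 2 by rewrite mulr_ge0 ?sqr_ge0// ltW.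
have : 0 <= kappa * enorm (lam t - l) ^+ 2 by rewrite mulr_ge0 ?sqr_ge0// ltW.
rewrite /potential; lra.
Qed.

(** The energy estimate: sum the potential inequality, starting from
    [lam 0 = 0] and vanishing displacements. *)
Lemma energy_estimate T y l : X y -> nonnegv l ->
  \sum_(t < T) gamma t *
    (dotv (F y) (x t.+1 - y) - dotv (lam t.+1) (g y) + dotv l (g (x t.+1)))
  + kappa / 2 * enorm (lam T - l) ^+ 2 <=
  3 * L * enorm (x 0%N - y) ^+ 2 + kappa * enorm l ^+ 2.
Proof.
move=> Xy l0.
have -> : 3 * L * enorm (x 0%N - y) ^+ 2 + kappa * enorm l ^+ 2 = potential 0 y l.
  rewrite /potential /d /e /= !subrr !(dotvC 0) !dotv0 !enorm0 (run_lam0 run).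
  by rewrite sub0r enormN; ring.
apply: (@le_trans _ _ (\sum_(t < T) gamma t * gap t y l + potential T y l)).
  rewrite lerD ?potential_ge//; apply: ler_sum => t _.
  rewrite ler_pM2l ?gamma_gt0//.
  exact: gap_lower_bound P _ _ _ _ Xy (run_mem _) (lam_nonneg _).
elim: T => [|T IH]; first by rewrite big_ord0 add0r.
rewrite big_ord_recr/= -addrA; apply: le_trans IH.
by rewrite lerD2l potential_step.
Qed.

Section Multiplier.
Context {xs : 'cV[R]_n} {ls : 'cV[R]_m}.
Hypothesis xs_feas : feasible X g xs.
Hypothesis kkt : KKT X F g dg xs ls.

Let Xxs : X xs. Proof. by case: xs_feas. Qed.
Let ls0 : nonnegv ls. Proof. by case: kkt. Qed.

(** At [xs] and [ls] every gap is nonnegative, so the energy estimate is a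
    uniform bound on the distance from [lam T] to [ls]. *)
Lemma lam_bounded : exists B, forall t, enorm (lam t) <= B.
Proof.
pose E := 3 * L * enorm (x 0%N - xs) ^+ 2 + kappa * enorm ls ^+ 2.
have E0 : 0 <= E.
  by apply: addr_ge0; apply: mulr_ge0; rewrite ?sqr_ge0 ?(ltW kappa_gt0) ?mulr_ge0 ?(ltW L0).
exists (enorm ls + Num.sqrt (2 / kappa * E)) => T.
rewrite -(subrKC ls (lam T)) (le_trans (enormD _ _))// lerD2l.
apply: enorm_le; first exact: sqrtr_ge0.
have k0 : 0 < 2 / kappa by rewrite divr_gt0.
rewrite sqr_sqrtr; last by apply: mulr_ge0 => //; exact: ltW.
rewrite -sqr_enorm -ler_pdivrMl// invf_div.
apply: le_trans (energy_estimate T Xxs ls0); rewrite lerDr; apply: sumr_ge0 => t _.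
rewrite mulr_ge0 ?(ltW (gamma_gt0 t))//.
have := KKT_lagrangian_ge0 P Xxs kkt (run_mem t.+1).
have : dotv (lam t.+1) (g xs) <= 0.
  apply: sumr_le0 => j _; case: xs_feas => _ /(_ j) gj.
  by rewrite mulr_ge0_le0// lam_nonneg.
lra.
Qed.

Lemma gamma_lower_bound : exists2 c, 0 < c & forall t, c <= gamma t.
Proof.
have [B lamB] := lam_bounded; have B0 : 0 <= B := le_trans (enorm_ge0 _) (lamB 0%N).
have E0 : 0 < 6 * L + 6 * l2agg Lg * B.
  by rewrite ltr_wpDr ?mulr_gt0// !mulr_ge0 ?l2agg_ge0.
exists (6 * L / (6 * L + 6 * l2agg Lg * B)) => [|t]; first by rewrite divr_gt0 ?mulr_gt0.
rewrite /gamma /step_gamma eta0E ler_pM2l ?mulr_gt0// lef_pV2 ?posrE ?eta_gt0//.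
rewrite lerD2l ler_wpM2l ?mulr_ge0 ?l2agg_ge0//.
by apply: bigmax_le => // i _.
Qed.

Lemma sum_gamma_ge : exists2 c, 0 < c & forall T, T%:R * c <= \sum_(t < T) gamma t.
Proof.
have [c c0 cg] := gamma_lower_bound; exists c => // T.
rewrite mulr_natl -[T in leLHS]card_ord -sumr_const.
by apply: ler_sum => t _; exact: cg.
Qed.

Let xbar T := output gamma x T.
Let W T := \sum_(t < T) gamma t.

(** Jensen's inequality applied to the energy estimate. *)
Lemma averaged_energy T y l : (0 < T)%N -> feasible X g y -> nonnegv l ->
  W T * (dotv (F y) (xbar T - y) + dotv l (g (xbar T))) <=
  3 * L * enorm (x 0%N - y) ^+ 2 + kappa * enorm l ^+ 2.
Proof.
move=> T0 [Xy gy] l0; apply: le_trans (energy_estimate T Xy l0).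
have [_ /(_ (fun z => dotv (F y) (z - y) + dotv l (g z)))] :=
  output_mem_jensen (FCVI_convex_set P) gamma_gt0 run_mem T0.
move=> /(_ (lagrangian_convex P _ l0))/le_trans; apply.
apply: ler_wpDr; first by rewrite mulr_ge0 ?sqr_ge0// divr_ge0// ltW.
apply: ler_sum => t _; rewrite ler_pM2l ?gamma_gt0// lerD2r lerDl oppr_ge0.
by apply: sumr_le0 => j _; rewrite mulr_ge0_le0// lam_nonneg.
Qed.

(** The total weight grows at least linearly, so a bound on the weighted value
    is a rate; [B / c] is a bound for negative [v] too since [B] is
    nonnegative. *)
Lemma rate_of_weighted_bound : exists2 c, 0 < c & forall T v B,
  (0 < T)%N -> 0 <= B -> W T * v <= B -> v <= B / c / T%:R.
Proof.
have [c c0 Wc] := sum_gamma_ge; exists c => // T v B T0 B0 WB.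
have T1 : 0 < T%:R :> R by rewrite ltr0n.
rewrite ler_pdivlMr// ler_pdivlMr// -mulrA mulrC.
have [v0|v0] := leP 0 v; first by rewrite (le_trans _ WB)// ler_wpM2r.
by apply: le_trans B0; rewrite mulr_ge0_le0 ?(ltW v0) ?mulr_ge0 ?(ltW c0).
Qed.

(** The test multiplier is 0; compactness makes the initial distance uniform
    in [y]. *)
Lemma gap_rate : exists2 C, 0 <= C & forall T y, (0 < T)%N -> feasible X g y ->
  dotv (F y) (xbar T - y) <= C / T%:R.
Proof.
have [c c0 rate] := rate_of_weighted_bound.
have [B XB] := compact_enorm_bounded (FCVI_compact P).
have L3 : 0 <= 3 * L by rewrite mulr_ge0// ltW.
have B1 : 0 <= 3 * L * (B + B) ^+ 2 by rewrite mulr_ge0 ?sqr_ge0.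
exists (3 * L * (B + B) ^+ 2 / c) => [|T y T0 fy]; first by rewrite divr_ge0// ltW.
apply: rate => //.
have /(averaged_energy T0 fy) : @nonnegv R m 0 by move=> j; rewrite mxE.
rewrite (dotvC 0) dotv0 addr0 enorm0 expr0n mulr0 addr0 => /le_trans; apply.
have [Xy _] := fy; rewrite ler_wpM2l//.
rewrite ler_pXn2r ?nnegrE ?enorm_ge0 ?addr_ge0 ?(le_trans (enorm_ge0 _) (XB _ Xy))//.
by rewrite (le_trans (enormD _ _))// enormN lerD ?XB//; exact: run_mem.
Qed.

(** The multiplier [ls + w / |w|], with [w] the violation at the average,
    makes the Lagrangian gap at [xs] at least [|w|], because the part due
    to [ls] is nonnegative by the optimality conditions. *)
Lemma infeasibility_rate : exists2 C, 0 <= C & forall T, (0 < T)%N ->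
  enorm (pospart (g (xbar T))) <= C / T%:R.
Proof.
have [c c0 rate] := rate_of_weighted_bound.
pose B := 3 * L * enorm (x 0%N - xs) ^+ 2 + kappa * (enorm ls + 1) ^+ 2.
have B0 : 0 <= B.
  by apply: addr_ge0; apply: mulr_ge0; rewrite ?sqr_ge0 ?(ltW kappa_gt0) ?mulr_ge0 ?(ltW L0).
exists (B / c) => [|T T0]; first by rewrite divr_ge0// ltW.
set w := pospart _; apply: rate => //.
have [->|w0] := eqVneq (enorm w) 0; first by rewrite mulr0.
have {}w0 : 0 < enorm w by rewrite lt0r w0 enorm_ge0.
have wpos : nonnegv w by move=> j; rewrite mxE le_max lexx orbT.
have ww : dotv w (g (xbar T)) = enorm w ^+ 2.
  rewrite sqr_enorm; apply: eq_bigr => j _; rewrite !mxE.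
  by case: leP => // _; rewrite !mul0r.
pose l := ls + (enorm w)^-1 *: w.
have l0 : nonnegv l by move=> j; rewrite mxE addr_ge0// mxE mulr_ge0 ?invr_ge0 ?enorm_ge0.
have l1 : enorm l <= enorm ls + 1.
  rewrite (le_trans (enormD _ _))// lerD2l enormZ ger0_norm ?invr_ge0 ?enorm_ge0//.
  by rewrite mulVf// gt_eqF.
have [Xxbar _] : X (xbar T) /\ _ := output_mem_jensen (FCVI_convex_set P) gamma_gt0 run_mem T0.
apply: (@le_trans _ _ (W T * (dotv (F xs) (xbar T - xs) + dotv l (g (xbar T))))).
  rewrite ler_wpM2l ?sumr_ge0// => [t _|]; first exact/ltW/gamma_gt0.
  rewrite /l dotvDl dotvZl ww addrA expr2 mulKf ?gt_eqF// lerDr.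
  exact (KKT_lagrangian_ge0 P Xxs kkt Xxbar).
apply: (le_trans (averaged_energy T0 xs_feas l0)).
rewrite lerD2l ler_pM2l//.
by rewrite ler_pXn2r ?nnegrE ?addr_ge0 ?enorm_ge0.
Qed.

End Multiplier.
End Run.

Theorem corollary1 (R : realType) (n m : nat)
    (X : set 'cV[R]_n) (F : 'cV[R]_n -> 'cV[R]_n)
    (g : 'cV[R]_n -> 'cV[R]_m) (dg : 'cV[R]_n -> 'M[R]_(n, m))
    (L : R) (Mg Lg : 'I_m -> R)
    (x : nat -> 'cV[R]_n) (lam : nat -> 'cV[R]_m) (gm1 : R)
    (eta := step_eta L (l2agg Lg) lam)
    (tau := fun t => step_beta L (l2agg Mg) * eta t)
    (gamma := step_gamma eta)
    (theta := step_theta gm1 gamma) :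
  smooth_FCVI X F g dg L Mg Lg ->
  (exists xs ls, FCVI_solution X F g xs /\ KKT X F g dg xs ls) ->
  AdOpEx_run X F g dg eta tau theta x lam ->
  exists C : R, forall T : nat, (0 < T)%N ->
    (exists2 M,
       is_max [set dotv (F y) (output gamma x T - y) | y in feasible X g] M &
       M <= C / T%:R) /\
    enorm (pospart (g (output gamma x T))) <= C / T%:R.
Proof.
move=> P [xs [ls [[fxs _] kkt]]] run.
have [C1 C10 gapC] := gap_rate P run fxs kkt.
have [C2 C20 infC] := infeasibility_rate P run fxs kkt.
have CT C T : C <= C1 + C2 -> C / T%:R <= (C1 + C2) / T%:R.
  by move=> CC; rewrite ler_wpM2r ?invr_ge0.
exists (C1 + C2) => T T0; split; last first.
  by rewrite (le_trans (infC T T0))// CT// lerDr.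
have [y fy ymax] := gap_max_exists P (output gamma x T) (ex_intro _ xs fxs).
exists (dotv (F y) (output gamma x T - y)) => //.
by rewrite (le_trans (gapC T y T0 fy))// CT// lerDl.
Qed.
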